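(* Let $k\ge 3$, let $C_{2k}=v_1v_2\cdots v_{2k}v_1$ be a cycle, let $i,j$ be integers with $4<i<j\le 2k$, and let $n_i,n_j\ge 0$ be integers. Let $G$ be the graph on $n=2k+n_i+n_j$ vertices obtained from $C_{2k}$ and two stars $S_{n_i+1}$, $S_{n_j+1}$ by identifying $v_i$ with the center of $S_{n_i+1}$ and $v_j$ with the center of $S_{n_j+1}$ (i.e. attaching $n_i$ pendant vertices at $v_i$ and $n_j$ pendant vertices at $v_j$). Let $G'=G-v_1v_2+v_1v_4$. Then $$\operatorname{per} L(G)>\operatorname{per} L(G').$$
   Context: For a simple graph $G$, $L(G)=D(G)-A(G)$ is its Laplacian matrix, where $D(G)$ is the diagonal matrix of vertex degrees and $A(G)$ the adjacency matrix. The permanent of an $n\times n$ matrix $X=(x_{ij})$ is $\operatorname{per} X=\sum_{\sigma\in S_n}\prod_{t=1}^n x_{t\sigma(t)}$. $S_m$ denotes the star on $m$ vertices (so $S_1$ is a single vertex). $G-e$ / $G+e$ denote deletion / addition of an edge $e$. *)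

(* Defs.v *)
From HB Require Import structures.
From mathcomp Require Import all_boot all_order all_algebra all_fingroup.
Set Implicit Arguments. Unset Strict Implicit. Unset Printing Implicit Defensive.
Import GRing.Theory Num.Theory.
Local Open Scope ring_scope.

Definition per (R : comNzRingType) (n : nat) (A : 'M[R]_n) : R :=
  \sum_(s : 'S_n) \prod_(t < n) A t (s t).

(* Simple graphs on vertex set 'I_n given by a symmetric irreflexive
   adjacency relation; degree and Laplacian matrix L = D - A over int. *)
Definition gdeg (n : nat) (adj : rel 'I_n) (a : 'I_n) : nat :=
  #|[set b | adj a b]|.

Definition laplacian (n : nat) (adj : rel 'I_n) : 'M[int]_n :=
  \matrix_(a, b) (if a == b then (gdeg adj a)%:Z else - (adj a b)%:Z).

Local Open Scope nat_scope.
Definition is_edge (a b x y : nat) : bool :=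
  ((a == x) && (b == y)) || ((a == y) && (b == x)).

(* Vertex numbering (0-based): cycle vertex v_m (1 <= m <= 2k) is m-1;
   the n_i pendant vertices at v_i are 2k, ..., 2k+n_i-1;
   the n_j pendant vertices at v_j are 2k+n_i, ..., 2k+n_i+n_j-1. *)
Definition G_adj_nat (k i j ni nj : nat) (a b : nat) : bool :=
  [|| [&& a < k.*2, b < k.*2 & ((a.+1 %% k.*2 == b) || (b.+1 %% k.*2 == a))],
      [&& k.*2 <= a, a < k.*2 + ni & b == i.-1],
      [&& k.*2 <= b, b < k.*2 + ni & a == i.-1],
      [&& k.*2 + ni <= a, a < k.*2 + ni + nj & b == j.-1]
    | [&& k.*2 + ni <= b, b < k.*2 + ni + nj & a == j.-1] ].

Definition Gp_adj_nat (k i j ni nj : nat) (a b : nat) : bool :=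
  (G_adj_nat k i j ni nj a b && ~~ is_edge a b 0 1) || is_edge a b 0 3.

Definition G_adj (k i j ni nj : nat) : rel 'I_(k.*2 + ni + nj) :=
  fun a b => G_adj_nat k i j ni nj a b.

Definition Gp_adj (k i j ni nj : nat) : rel 'I_(k.*2 + ni + nj) :=
  fun a b => Gp_adj_nat k i j ni nj a b.
Arguments G_adj k i j ni nj : clear implicits.
Arguments Gp_adj k i j ni nj : clear implicits.

(* Main.v *)
Require Import Defs.
From HB Require Import structures.
From mathcomp Require Import all_boot all_order all_algebra all_fingroup.
From mathcomp Require Import zify ring.
Import Order.TTheory GRing.Theory Num.Theory.
Local Open Scope ring_scope.
Set Implicit Arguments. Unset Strict Implicit. Unset Printing Implicit Defensive.

(* Both graphs are bipartite, so the signs of L can be conjugated away and the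
   permanent of the nonnegative matrix D + A may be used instead.  L(G) and
   L(G') differ only in the rows of v_1, v_2, v_4.  Expand both permanents along
   the rows of v_1, ..., v_4, and let t_{xy} be the sum over the ways in which
   the other rows use all columns but v_2, v_3, x, y.  With l = v_{2k},
   per L(G) - per L(G')
     = 2 (3 t_{14} + 3 t_{15} + t_{4l} + t_{5l} - t_{1l} - t_{45}).
   Here t_{14} >= 1 because of the identity permutation, while t_{1l} and t_{45}
   are at most 1: the only permutations that contribute follow the long path
   between v_4 and v_1 and fix the pendant vertices.
   Below, v0, ..., v4, v5 stand for v_1, ..., v_5, v_{2k}. *)

(** * The signless Laplacian D + A and its rows *)

Definition signless (n : nat) (adj : rel 'I_n) : 'M[int]_n :=
  \matrix_(a, b) (if a == b then (gdeg adj a)%:Z else (adj a b)%:Z).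

(* Conjugating by the diagonal matrix of signs (-1)^c preserves [per]. *)
Lemma per_laplacian_bipartite (n : nat) (adj : rel 'I_n) (c : 'I_n -> bool) :
  (forall a b, adj a b -> c a != c b) ->
  per (laplacian adj) = per (signless adj).
Proof.
move=> bip; rewrite /per; apply: eq_bigr => s _.
(* [s] permutes the vertices, so the row signs and the column signs have the same product and
   cancel. *)
have sgn1 : \prod_(t < n) ((-1) ^+ c t * (-1) ^+ c (s t)) = 1 :> int.
  rewrite big_split /= [X in X * _](reindex_inj (@perm_inj _ s)) -big_split /=.
  by apply: big1 => t _; rewrite -signr_addb addbb.
rewrite -[LHS]mul1r -[X in X * _ = _]sgn1 {sgn1} -big_split /=; apply: eq_bigr => t _.
rewrite !mxE; case: eqP => [<-|_]; first by rewrite -signr_addb addbb mul1r.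
case: (boolP (adj t (s t))) => [/bip|_]; last by rewrite oppr0 mulr0.
by case: (c t); case: (c (s t)).
Qed.

Lemma gdeg_size (n : nat) (adj : rel 'I_n) (a : 'I_n) (l : seq 'I_n) :
  uniq l -> (forall x, adj a x = (x \in l)) -> gdeg adj a = size l.
Proof.
move=> ul adjE; rewrite /gdeg -(card_uniqP ul).
by apply: eq_card => x; rewrite inE adjE.
Qed.

(** Supplies the shape that [sparse_row] asks for, once the neighbours are listed. *)
Lemma signless_row (n : nat) (adj : rel 'I_n) (a x : 'I_n) (l : seq 'I_n) :
  uniq (a :: l) -> (forall y, adj a y = (y \in l)) ->
  signless adj a x = (size l)%:R * (x == a)%:R + \sum_(y <- l) (x == y)%:R.
Proof.
move=> /= /andP[al ul] adjE; rewrite mxE (gdeg_size ul adjE) adjE.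
have -> : \sum_(y <- l) (x == y)%:R = (x \in l)%:R :> int.
  elim: l ul {al adjE} => [|y l IHl] /=; first by rewrite big_nil.
  case/andP=> yl ul; rewrite big_cons IHl // inE.
  by case: eqP => [->|] /=; rewrite ?(negPf yl) ?add0r ?addr0.
rewrite eq_sym; case: eqP => [->|_]; last by rewrite mulr0 add0r; case: (_ \in _).
by rewrite (negPf al) addr0 mulr1 natz.
Qed.

Lemma signless_ge0 (m : nat) (adj : rel 'I_m) t x : 0 <= signless adj t x.
Proof. by rewrite mxE; case: eqP. Qed.

Lemma signless_neq0 (m : nat) (adj : rel 'I_m) t x :
  signless adj t x != 0 -> x = t \/ adj t x.
Proof.
rewrite mxE; case: (t =P x) => [->|_]; first by left.
by case: (adj t x) => // _; right.
Qed.

(** * Expansion of a permanent along four rows *)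

Section FourRows.

Variables (n : nat) (v0 v1 v2 v3 v4 v5 : 'I_n).
Hypothesis uv : uniq [:: v0; v1; v2; v3; v4; v5].

Let uniq4 : uniq [:: v0; v1; v2; v3] := take_uniq 4 uv.

(* The entries in the rows v0, ..., v3 are left out, which makes this symmetric
   in x0, ..., x3. *)
Definition rowcof (A : 'M[int]_n) (x0 x1 x2 x3 : 'I_n) : int :=
  \sum_(s : 'S_n) (\prod_(t | t \notin [:: v0; v1; v2; v3]) A t (s t))
     * (s v0 == x0)%:R * (s v1 == x1)%:R * (s v2 == x2)%:R * (s v3 == x3)%:R.

Lemma eq_rowcof (A B : 'M[int]_n) x0 x1 x2 x3 :
  (forall t x, t \notin [:: v0; v1; v2; v3] -> A t x = B t x) ->
  rowcof A x0 x1 x2 x3 = rowcof B x0 x1 x2 x3.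
Proof.
move=> AB; apply: eq_bigr => s _; do 4 congr (_ * _).
by apply: eq_bigr => t ht; rewrite AB.
Qed.

Lemma per_split4 (A : 'M[int]_n) :
  per A = \sum_(s : 'S_n) (\prod_(t | t \notin [:: v0; v1; v2; v3]) A t (s t))
     * A v0 (s v0) * A v1 (s v1) * A v2 (s v2) * A v3 (s v3).
Proof.
apply: eq_bigr => s _; rewrite (bigID (mem [:: v0; v1; v2; v3])) /=.
rewrite -big_uniq; last exact: uniq4.
by rewrite !big_cons big_nil /=; ring.
Qed.

(** Precomposing with a transposition of two of the four rows leaves every factor outside them
    unchanged. *)
Lemma rowcof_reindex (A : 'M[int]_n) (x y : 'I_n) (F : 'S_n -> int) :
  x \in [:: v0; v1; v2; v3] -> y \in [:: v0; v1; v2; v3] ->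
  \sum_(s : 'S_n) (\prod_(t | t \notin [:: v0; v1; v2; v3]) A t (s t)) * F s =
  \sum_(s : 'S_n) (\prod_(t | t \notin [:: v0; v1; v2; v3]) A t (s t))
     * F (tperm x y * s)%g.
Proof.
move=> hx hy; rewrite (reindex_inj (mulgI (tperm x y))) /=.
apply: eq_bigr => s _; congr (_ * _); apply: eq_bigr => t ht.
by rewrite permM tpermD //; apply: contraNneq ht => <-.
Qed.

(** With the next two swaps this generates all permutations of the four column arguments. *)
Lemma rowcofC01 A x0 x1 x2 x3 : rowcof A x0 x1 x2 x3 = rowcof A x1 x0 x2 x3.
Proof.
rewrite /rowcof; under eq_bigr do rewrite -!mulrA.
rewrite (@rowcof_reindex A v0 v1) ?inE ?eqxx ?orbT //.
apply: eq_bigr => s _; rewrite !permM tpermL tpermR.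
move: uv; rewrite /= !inE => uv'.
rewrite !tpermD; try (by apply: contraTneq uv' => ->; rewrite !eqxx ?orbT ?andbF).
by ring.
Qed.

Lemma rowcofC12 A x0 x1 x2 x3 : rowcof A x0 x1 x2 x3 = rowcof A x0 x2 x1 x3.
Proof.
rewrite /rowcof; under eq_bigr do rewrite -!mulrA.
rewrite (@rowcof_reindex A v1 v2) ?inE ?eqxx ?orbT //.
apply: eq_bigr => s _; rewrite !permM tpermL tpermR.
move: uv; rewrite /= !inE => uv'.
rewrite !tpermD; try (by apply: contraTneq uv' => ->; rewrite !eqxx ?orbT ?andbF).
by ring.
Qed.

Lemma rowcofC23 A x0 x1 x2 x3 : rowcof A x0 x1 x2 x3 = rowcof A x0 x1 x3 x2.
Proof.
rewrite /rowcof; under eq_bigr do rewrite -!mulrA.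
rewrite (@rowcof_reindex A v2 v3) ?inE ?eqxx ?orbT //.
apply: eq_bigr => s _; rewrite !permM tpermL tpermR.
move: uv; rewrite /= !inE => uv'.
rewrite !tpermD; try (by apply: contraTneq uv' => ->; rewrite !eqxx ?orbT ?andbF).
by ring.
Qed.

Lemma rowcof_nuniq A x0 x1 x2 x3 :
  ~~ uniq [:: x0; x1; x2; x3] -> rowcof A x0 x1 x2 x3 = 0.
Proof.
move=> nu; apply: big1 => s _; case: (s v0 =P x0) => [e0|]; last by rewrite mulr0 !mul0r.
case: (s v1 =P x1) => [e1|]; last by rewrite mulr0 !mul0r.
case: (s v2 =P x2) => [e2|]; last by rewrite mulr0 !mul0r.
case: (s v3 =P x3) => [e3|]; last by rewrite mulr0.
case/negP: nu; rewrite -e0 -e1 -e2 -e3 -[[:: _; _; _; _]]/(map s [:: v0; v1; v2; v3]).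
rewrite (map_inj_uniq (@perm_inj _ s)).
exact: uniq4.
Qed.

(** Some row must use column [v]; if it is none of the four, it contributes a zero factor. *)
Lemma rowcof_uncovered (A : 'M[int]_n) (v : 'I_n) x0 x1 x2 x3 :
  (forall t, t \notin [:: v0; v1; v2; v3] -> A t v = 0) ->
  v \notin [:: x0; x1; x2; x3] -> rowcof A x0 x1 x2 x3 = 0.
Proof.
move=> Av nv; apply: big1 => s _.
case: (s v0 =P x0) => [e0|]; last by rewrite mulr0 !mul0r.
case: (s v1 =P x1) => [e1|]; last by rewrite mulr0 !mul0r.
case: (s v2 =P x2) => [e2|]; last by rewrite mulr0 !mul0r.
case: (s v3 =P x3) => [e3|]; last by rewrite mulr0.
have ht : (s^-1)%g v \notin [:: v0; v1; v2; v3].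
  by apply: contra nv => /(map_f s); rewrite permKV /= e0 e1 e2 e3.
by rewrite (bigD1 ((s^-1)%g v)) //= permKV Av // !mul0r.
Qed.

(** * Bounds on the cofactors *)

Lemma rowcof_ge0 (A : 'M[int]_n) x0 x1 x2 x3 :
  (forall t x, 0 <= A t x) -> 0 <= rowcof A x0 x1 x2 x3.
Proof.
move=> A0; apply: sumr_ge0 => s _; rewrite !mulr_ge0 ?ler0n //.
exact: prodr_ge0.
Qed.

Lemma rowcof_id_ge1 (A : 'M[int]_n) :
  (forall t x, 0 <= A t x) ->
  (forall t, t \notin [:: v0; v1; v2; v3] -> 1 <= A t t) ->
  1 <= rowcof A v0 v1 v2 v3.
Proof.
move=> A0 A1; rewrite /rowcof (bigD1 (1%g : 'S_n)) //= !perm1 !eqxx !mulr1.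
apply: ler_wpDr.
  by apply: sumr_ge0 => s _; rewrite !mulr_ge0 ?ler0n // prodr_ge0.
under eq_bigr do rewrite perm1.
by apply: (big_ind (fun y : int => 1 <= y)) => // y z; apply: mulr_ege1.
Qed.

(** [S] isolates the one permutation whose term may be nonzero; that term is a product of factors
    between 0 and 1. *)
Lemma rowcof_le1 (A : 'M[int]_n) (S : 'S_n -> Prop) x0 x1 x2 x3 :
  (forall s : 'S_n, s v0 = x0 -> s v1 = x1 -> s v2 = x2 -> s v3 = x3 ->
    (forall t, t \notin [:: v0; v1; v2; v3] -> A t (s t) != 0) -> S s) ->
  (forall s s' : 'S_n, S s -> S s' -> s = s') ->
  (forall (s : 'S_n) t, S s -> t \notin [:: v0; v1; v2; v3] -> 0 <= A t (s t) <= 1) ->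
  rowcof A x0 x1 x2 x3 <= 1.
Proof.
move=> suppS uniqS leS; rewrite /rowcof.
pose G (s : 'S_n) := (\prod_(t | t \notin [:: v0; v1; v2; v3]) A t (s t))
  * (s v0 == x0)%:R * (s v1 == x1)%:R * (s v2 == x2)%:R * (s v3 == x3)%:R.
have GS (s : 'S_n) : G s != 0 -> S s.
  rewrite /G; case: (s v0 =P x0) => [e0|]; last by rewrite mulr0 !mul0r eqxx.
  case: (s v1 =P x1) => [e1|]; last by rewrite mulr0 !mul0r eqxx.
  case: (s v2 =P x2) => [e2|]; last by rewrite mulr0 !mul0r eqxx.
  case: (s v3 =P x3) => [e3|]; last by rewrite mulr0 eqxx.
  rewrite !mulr1 => /prodf_neq0 An0; exact: suppS.
case: (pickP (fun s => G s != 0)) => [s Gs|G0]; last first.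
  by rewrite big1 // => s _; have /eqP := G0 s.
rewrite (bigD1 s) //= [X in _ + X]big1 ?addr0 => [|s' ss']; last first.
  apply/eqP; apply: contraNT ss' => Gs'; apply/eqP.
  by apply: uniqS; apply: GS.
have /andP[p0 p1] : 0 <= \prod_(t | t \notin [:: v0; v1; v2; v3]) A t (s t) <= 1.
  apply: (big_ind (fun y : int => 0 <= y <= 1)) => // [y z|t]; last by apply/leS/GS.
  by move=> /andP[y0 y1] /andP[z0 z1]; rewrite mulr_ge0 // mulr_ile1.
by rewrite !mulr_ile1 // ?mulr_ge0 ?ler0n ?lern1 ?leq_b1.
Qed.

(** * Sparse rows and the difference of two permanents *)

Definition vtx (q : nat) : 'I_n := nth v0 [:: v0; v1; v2; v3; v4; v5] q.

(** Columns are named by their index in [vtx], so that distinctness and sorting are decided by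
    computation. *)
Definition sparse_row (A : 'M[int]_n) (v : 'I_n) (r : seq (nat * int)) : Prop :=
  forall x, A v x = \sum_(q <- r) q.2 * (x == vtx q.1)%:R.

Lemma per_sparse (A : 'M[int]_n) r0 r1 r2 r3 :
  sparse_row A v0 r0 -> sparse_row A v1 r1 ->
  sparse_row A v2 r2 -> sparse_row A v3 r3 ->
  per A = \sum_(q3 <- r3) q3.2 * \sum_(q2 <- r2) q2.2 *
          \sum_(q1 <- r1) q1.2 * \sum_(q0 <- r0) q0.2 *
            rowcof A (vtx q0.1) (vtx q1.1) (vtx q2.1) (vtx q3.1).
Proof.
have expand (F : 'S_n -> int) v r : sparse_row A v r ->
    \sum_s F s * A v (s v) =
    \sum_(q <- r) q.2 * \sum_s F s * (s v == vtx q.1)%:R.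
  move=> Av; under eq_bigr do rewrite Av mulr_sumr.
  rewrite exchange_big; apply: eq_bigr => q _; rewrite mulr_sumr.
  by apply: eq_bigr => s _; rewrite mulrCA.
move=> A0 A1 A2 A3; rewrite per_split4 (expand _ _ _ A3).
apply: eq_bigr => q3 _; congr (_ * _).
under eq_bigr do rewrite mulrAC.
rewrite (expand _ _ _ A2); apply: eq_bigr => q2 _; congr (_ * _).
under eq_bigr => s do rewrite 2!(mulrAC _ (A v1 (s v1))).
rewrite (expand _ _ _ A1); apply: eq_bigr => q1 _; congr (_ * _).
under eq_bigr => s do rewrite 3!(mulrAC _ (A v0 (s v0))).
rewrite (expand _ _ _ A0); apply: eq_bigr => q0 _; congr (_ * _).
by apply: eq_bigr => s _; ring.
Qed.

(* A sorting network, which reduces to a sorted term on concrete indices. *)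
Definition sort4 (T : Type) (K : nat -> nat -> nat -> nat -> T) (a b c d : nat) : T :=
  let a1 := minn a b in let b1 := maxn a b in
  let c1 := minn c d in let d1 := maxn c d in
  let a2 := minn a1 c1 in let c2 := maxn a1 c1 in
  let b2 := minn b1 d1 in let d2 := maxn b1 d1 in
  K a2 (minn b2 c2) (maxn b2 c2) d2.

(** Brings every cofactor to a normal form with sorted indices. The existential makes [K] opaque to
    callers, so that rewriting with the equation terminates. *)
Lemma rowcof_vtx (A : 'M[int]_n) :
  (forall t, t \notin [:: v0; v1; v2; v3] -> A t v1 = 0) ->
  (forall t, t \notin [:: v0; v1; v2; v3] -> A t v2 = 0) ->
  exists2 K, K = (fun a b c d => rowcof A (vtx a) (vtx b) (vtx c) (vtx d)) &
  forall a b c d, rowcof A (vtx a) (vtx b) (vtx c) (vtx d) =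
    if [&& uniq [:: a; b; c; d], 1%N \in [:: a; b; c; d] & 2%N \in [:: a; b; c; d]]
    then sort4 K a b c d else 0.
Proof.
move=> A1 A2; pose K a b c d := rowcof A (vtx a) (vtx b) (vtx c) (vtx d); exists K => // a b c d.
(* Index 0 is excluded for [p] because [v0] is also the default of [nth], taken by all [q >= 6]. *)
have vtx_inj p q : (0 < p < 6)%N -> vtx p = vtx q -> p = q.
  case/andP=> p0 p6; case: (ltnP q 6) => q6 /eqP.
    by rewrite nth_uniq // => /eqP.
  rewrite {2}/vtx nth_default // -[v0]/(vtx 0) nth_uniq // => /eqP p0'.
  by rewrite p0' in p0.
have notin_vtx p : (0 < p < 6)%N -> p \notin [:: a; b; c; d] ->
    vtx p \notin [:: vtx a; vtx b; vtx c; vtx d].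
  move=> hp; apply: contra => /=; rewrite !inE => /or4P[] /eqP/(vtx_inj _ _ hp) <-;
  by rewrite eqxx ?orbT.
case: ifP => [_|/negbT].
  have K01 x y z w : K x y z w = K y x z w by apply: rowcofC01.
  have K12 x y z w : K x y z w = K x z y w by apply: rowcofC12.
  have K23 x y z w : K x y z w = K x y w z by apply: rowcofC23.
  have m01 x y z w : K x y z w = K (minn x y) (maxn x y) z w by case: leqP.
  have m23 x y z w : K x y z w = K x y (minn z w) (maxn z w) by case: leqP.
  have m02 x y z w : K x y z w = K (minn x z) y (maxn x z) w.
    by case: leqP => // _; rewrite K01 K12 K01.
  have m13 x y z w : K x y z w = K x (minn y w) z (maxn y w).
    by case: leqP => // _; rewrite K12 K23 K12.
  have m12 x y z w : K x y z w = K x (minn y z) (maxn y z) w by case: leqP.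
  by rewrite /sort4 -[LHS]/(K a b c d) m01 m23 m02 m13 m12.
case/nandP=> [nu|/nandP[n1|n2]].
- apply: rowcof_nuniq; apply: contra nu.
  exact: (map_uniq (f := vtx) (s := [:: a; b; c; d])).
- by apply: (rowcof_uncovered A1); apply: (notin_vtx 1%N).
- by apply: (rowcof_uncovered A2); apply: (notin_vtx 2%N).
Qed.

(** Columns v_2 and v_3 vanish outside the four rows, so every surviving cofactor is some t_{xy},
    and it remains to compare coefficients. Each sparse row lists the degree first, then the
    neighbours. *)
Lemma per_sub_four_rows (A B : 'M[int]_n) :
  (forall t, t \notin [:: v0; v1; v2; v3] -> A t v1 = 0) ->
  (forall t, t \notin [:: v0; v1; v2; v3] -> A t v2 = 0) ->
  (forall t x, t \notin [:: v0; v1; v2; v3] -> A t x = B t x) ->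
  sparse_row A v0 [:: (0%N, 2); (1%N, 1); (5%N, 1)] ->
  sparse_row A v1 [:: (1%N, 2); (0%N, 1); (2%N, 1)] ->
  sparse_row A v2 [:: (2%N, 2); (1%N, 1); (3%N, 1)] ->
  sparse_row A v3 [:: (3%N, 2); (2%N, 1); (4%N, 1)] ->
  sparse_row B v0 [:: (0%N, 2); (3%N, 1); (5%N, 1)] ->
  sparse_row B v1 [:: (1%N, 1); (2%N, 1)] ->
  sparse_row B v2 [:: (2%N, 2); (1%N, 1); (3%N, 1)] ->
  sparse_row B v3 [:: (3%N, 3); (0%N, 1); (2%N, 1); (4%N, 1)] ->
  per A - per B = 2 * (3 * rowcof A v0 v1 v2 v3 + 3 * rowcof A v0 v1 v2 v4
    + rowcof A v5 v1 v2 v3 + rowcof A v5 v1 v2 v4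
    - rowcof A v5 v1 v2 v0 - rowcof A v3 v1 v2 v4).
Proof.
move=> Av1 Av2 AB A0 A1 A2 A3 B0 B1 B2 B3.
rewrite (per_sparse A0 A1 A2 A3) (per_sparse B0 B1 B2 B3).
rewrite !(big_cons, big_nil) /=.
have BE x0 x1 x2 x3 : rowcof B x0 x1 x2 x3 = rowcof A x0 x1 x2 x3.
  by rewrite (@eq_rowcof A B).
rewrite !BE {BE}.
(* Literal indices let [sort4] compute, so equal cofactors become the same atom for [ring]. *)
rewrite -[v0]/(vtx 0) -[v1]/(vtx 1) -[v2]/(vtx 2) -[v3]/(vtx 3) -[v4]/(vtx 4) -[v5]/(vtx 5).
have [K _ KE] := rowcof_vtx Av1 Av2.
rewrite !KE /sort4 /=.
ring.
Qed.

End FourRows.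

(** * Edges, 2-colouring and the long path of G *)

Section Graph.

Local Open Scope nat_scope.

Variables k i j ni nj : nat.
Hypotheses (k3 : (3 <= k)%N) (i4 : (4 < i)%N) (ij : (i < j)%N) (j2k : (j <= k.*2)%N).

(** Replaces the modulus by the explicit closing edge v_{2k} v_1, which puts adjacency within reach
    of [lia]. *)
Lemma G_adj_natE a b : G_adj_nat k i j ni nj a b =
  [|| [&& a < k.*2, b < k.*2 & [|| a.+1 == b, b.+1 == a,
        (a == 0) && (b == k.*2.-1) | (b == 0) && (a == k.*2.-1)]],
      [&& k.*2 <= a, a < k.*2 + ni & b == i.-1],
      [&& k.*2 <= b, b < k.*2 + ni & a == i.-1],
      [&& k.*2 + ni <= a, a < k.*2 + ni + nj & b == j.-1]
    | [&& k.*2 + ni <= b, b < k.*2 + ni + nj & a == j.-1] ]%N.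
Proof.
have succ_mod x : (x < k.*2)%N -> x.+1 %% k.*2 = if x.+1 == k.*2 then 0%N else x.+1.
  by move=> xN; case: eqP => [->|xN']; [rewrite modnn | rewrite modn_small //; lia].
rewrite /G_adj_nat; congr (_ || _); case: (ltnP a k.*2) => //= aN.
case: (ltnP b k.*2) => //= bN; rewrite !succ_mod //.
by case: ifP => ?; case: ifP => ?; lia.
Qed.

Lemma G_adj_sym (a b : 'I_(k.*2 + ni + nj)) : G_adj k i j ni nj a b = G_adj k i j ni nj b a.
Proof.
rewrite /G_adj /G_adj_nat; congr (_ || _).
  by rewrite andbCA [(_ %% _ == _) || _]orbC.
by do 4 case: (_ && _).
Qed.

(* The parity of the cycle index, extended to the pendant vertices. *)
Definition colour (a : nat) : bool :=
  if (a < k.*2)%N then odd a else if (a < k.*2 + ni)%N then ~~ odd i.-1 else ~~ odd j.-1.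

(** The closing edge joins indices 0 and 2k - 1, of opposite parity because the cycle is even. *)
Lemma G_adj_colour a b : G_adj_nat k i j ni nj a b -> colour a != colour b.
Proof.
rewrite G_adj_natE /colour; case/or4P => [|||/orP[]] /and3P[].
- case: ltnP => // aN _; case: ltnP => // bN _.
  case/or4P => [/eqP<-|/eqP<-|/andP[/eqP-> /eqP->]|/andP[/eqP-> /eqP->]] /=; lia.
- move=> aN aN' /eqP->; rewrite aN' ifF; last lia. rewrite ifT; lia.
- move=> aN aN' /eqP->; rewrite aN' ifT; last lia. rewrite ifF; lia.
- move=> aN aN' /eqP->; rewrite ifF; last lia. rewrite ifF; last lia. rewrite ifT; lia.
- move=> aN aN' /eqP->; rewrite ifT; last lia. rewrite ifF; last lia. rewrite ifF; lia.
Qed.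

Lemma Gp_adj_colour a b : Gp_adj_nat k i j ni nj a b -> colour a != colour b.
Proof.
case/orP => [/andP[/G_adj_colour] //|].
by case/orP => /andP[/eqP-> /eqP->]; rewrite /colour !ifT //; lia.
Qed.

(** The cyclic permutation v_1 -> v_{2k} -> ... -> v_4 -> v_1, fixing v_2, v_3 and all pendant
    vertices. *)
Definition descend (x : nat) : nat :=
  if x == 0%N then k.*2.-1 else if x == 3 then 0%N
  else if (3 < x < k.*2)%N then x.-1 else x.

(* The column x - 1 can only be used by the row x, since the row x - 2 already
   uses another column, and a pendant neighbour must use its own column. *)
Lemma perm_descend (s : 'S_(k.*2 + ni + nj)) :
  (forall x, nat_of_ord x = 1%N -> s x = x) -> (forall x, nat_of_ord x = 2 -> s x = x) ->
  (forall x, nat_of_ord x = 3 -> nat_of_ord (s x) = 0%N) ->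
  (forall x, nat_of_ord x \notin [:: 1; 2; 3]%N -> s x = x \/ G_adj k i j ni nj x (s x)) ->
  forall x, nat_of_ord (s x) = descend (nat_of_ord x).
Proof.
move=> s1 s2 s3 sadj.
have step (u : 'I_(k.*2 + ni + nj)) :
  [\/ nat_of_ord u = 1%N /\ nat_of_ord (s u) = 1%N, nat_of_ord u = 2 /\ nat_of_ord (s u) = 2,
      nat_of_ord u = 3 /\ nat_of_ord (s u) = 0%N |
      nat_of_ord u \notin [:: 1; 2; 3]%N /\
       (nat_of_ord (s u) = nat_of_ord u \/ G_adj_nat k i j ni nj (nat_of_ord u) (nat_of_ord (s u)))].
  case: (eqVneq (nat_of_ord u) 1%N) => [e|n1]; first by constructor 1; rewrite s1.
  case: (eqVneq (nat_of_ord u) 2) => [e|n2]; first by constructor 2; rewrite s2.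
  case: (eqVneq (nat_of_ord u) 3) => [e|n3]; first by constructor 3; rewrite s3.
  constructor 4; split; first by rewrite !inE (negPf n1) (negPf n2) (negPf n3).
  have [|->|] := sadj u; [by rewrite !inE (negPf n1) (negPf n2) (negPf n3)| by left | by right].
(* Induction up the path: [u] is the row that uses column a - 1, and elimination leaves only u =
   a. *)
have path_val a : (3 <= a < k.*2)%N ->
    forall x : 'I_(k.*2 + ni + nj), nat_of_ord x = a -> nat_of_ord (s x) = descend a.
  elim/ltn_ind: a => a IH aN x xa.
  case: (eqVneq a 3) => [a3|na3].
    by rewrite a3 in xa *; rewrite s3 // /descend /=.
  have bn : (a.-1 < k.*2 + ni + nj)%N by lia.
  pose y := Ordinal bn; pose u := (s^-1)%g y.
  have su : s u = y by rewrite permKV.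
  have vsu : nat_of_ord (s u) = a.-1 by rewrite su.
  have sy : nat_of_ord (s y) = descend a.-1 by apply: (IH a.-1) => //; lia.
  have uy : nat_of_ord u <> a.-1.
    move=> e; have : nat_of_ord (s u) = nat_of_ord (s y) by congr (nat_of_ord (s _)); apply: ord_inj.
    by rewrite vsu sy /descend; do !case: ifP; lia.
  (* For a = 4 the row a - 2 is v_3, which is fixed by hypothesis and lies below the range of the
     induction. *)
  have ua2 : nat_of_ord u <> a.-2.
    move=> e; case: (eqVneq a 4) => [a4|na4].
      by move: vsu; rewrite s2 //; lia.
    have : nat_of_ord (s u) = descend a.-2 by apply: (IH a.-2) => //; lia.
    by rewrite vsu /descend; do !case: ifP; lia.
  (* If [u] were pendant, its column would fall to its only neighbour, row a - 1, whose image is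
     already known to lie on the cycle. *)
  have upend : (nat_of_ord u < k.*2)%N.
    rewrite ltnNge; apply/negP => uN.
    pose z := (s^-1)%g u; have sz : s z = u by rewrite permKV.
    have := step z; rewrite sz.
    case=> [[]|[]|[]|[zn]]; try lia.
    case=> [e|].
      have e' : z = u by apply: ord_inj.
      by apply: uy; rewrite -vsu -e' sz e'.
    have := step u; rewrite vsu.
    case=> [[]|[]|[]|[un]]; try lia.
    case; first lia.
    rewrite !G_adj_natE => h1 h2.
    have zy : nat_of_ord z = a.-1 by lia.
    have : nat_of_ord (s z) = nat_of_ord (s y) by congr (nat_of_ord (s _)); apply: ord_inj.
    by rewrite sz sy /descend; do !case: ifP; lia.
  have ua : nat_of_ord u = a.
    have := step u; rewrite vsu.
    case=> [[]|[]|[]|[un]]; try lia.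
    case; first lia.
    rewrite G_adj_natE; lia.
  have -> : x = u by apply: ord_inj; rewrite xa ua.
  by rewrite vsu /descend; do !case: ifP; lia.
(* The only neighbour of a pendant vertex lies on the path and has its image on the cycle, so it
   cannot use column [x]. *)
have pend_val (x : 'I_(k.*2 + ni + nj)) : (k.*2 <= nat_of_ord x)%N -> s x = x.
  move=> xN; pose z := (s^-1)%g x; have sz : s z = x by rewrite permKV.
  have := step z; rewrite sz.
  case=> [[]|[]|[]|[zn]]; try lia.
  case=> [e|]; first by rewrite -[in LHS](_ : z = x) //; apply: ord_inj.
  rewrite G_adj_natE => h.
  have : nat_of_ord (s z) = descend (nat_of_ord z) by apply: path_val => //; lia.
  by rewrite sz /descend; do !case: ifP; lia.
move=> x; case: (ltnP (nat_of_ord x) k.*2) => xN; last first.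
  by rewrite pend_val // /descend; do !case: ifP; lia.
case: (ltnP (nat_of_ord x) 3) => x3; last by apply: path_val => //; lia.
case: (eqVneq (nat_of_ord x) 0%N) => [x0|nx0]; last first.
  have sx : s x = x by case: (eqVneq (nat_of_ord x) 1%N) => [/s1|n1] //; apply: s2; lia.
  by rewrite sx /descend; do !case: ifP; lia.
(* Row v_1 comes last: column 2k - 1 is used by no other row. *)
have bn : (k.*2.-1 < k.*2 + ni + nj)%N by lia.
pose y := Ordinal bn; pose u := (s^-1)%g y.
have su : nat_of_ord (s u) = k.*2.-1 by rewrite permKV.
suff e : x = u by rewrite [in LHS]e su x0.
apply: ord_inj; rewrite x0.
case: (ltnP (nat_of_ord u) k.*2) => uN; last by move: su; rewrite pend_val //; lia.
case: (ltnP (nat_of_ord u) 3) => u3.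
  have := step u; rewrite su; case=> [[]|[]|[]|[un _]]; try lia.
  by move: un; rewrite !inE; lia.
have : nat_of_ord (s u) = descend (nat_of_ord u) by apply: path_val => //; lia.
by rewrite su /descend; do !case: ifP; lia.
Qed.

End Graph.

(** * Entries of D + A for the two graphs *)

Section Bounds.

Variables k i j ni nj : nat.
Hypotheses (k3 : (3 <= k)%N) (i4 : (4 < i)%N) (ij : (i < j)%N) (j2k : (j <= k.*2)%N).
Local Notation n := (k.*2 + ni + nj)%N.
Local Notation A := (signless (G_adj k i j ni nj)).

(** A pendant vertex has degree 1, so diagonal entries above 1 occur only on the cycle. *)
Lemma signless_le1 (t x : 'I_n) : (t != x) || (k.*2 <= t)%N -> A t x <= 1.
Proof.
rewrite mxE; case: eqP => [_ /= tN|_ _]; last by case: (G_adj _ _ _ _ _ _ _).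
have bn : ((if t < k.*2 + ni then i.-1 else j.-1) < n)%N by case: ifP; lia.
rewrite (@gdeg_size _ _ _ [:: Ordinal bn]) // => x'.
rewrite inE -val_eqE /= /G_adj G_adj_natE //.
by case: (ltnP t (k.*2 + ni)); have := ltn_ord t; lia.
Qed.

(** Since i, j > 4, no pendant vertex hangs at v_1, ..., v_4, whose rows are those of the bare
    cycle. *)
Lemma G_adj_near (a b : nat) : (a < 4)%N ->
  G_adj_nat k i j ni nj a b = [|| b == a.+1, b.+1 == a | (a == 0) && (b == k.*2.-1)]%N.
Proof.
move=> a4; rewrite G_adj_natE //.
have -> : (a < k.*2)%N by lia.
have -> : (k.*2 <= a)%N = false by lia.
have -> : (k.*2 + ni <= a)%N = false by lia.
have -> : (a == i.-1) = false by lia.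
have -> : (a == j.-1) = false by lia.
by rewrite !andbF !orbF /=; lia.
Qed.

Lemma gdeg_G_gt0 (t : 'I_n) : (3 < t)%N -> (0 < gdeg (G_adj k i j ni nj) t)%N.
Proof.
move=> t3; apply/card_gt0P.
have bn : ((if t < k.*2 then t.-1 else if t < k.*2 + ni then i.-1 else j.-1) < n)%N.
  by have := ltn_ord t; do !case: ifP; lia.
exists (Ordinal bn); rewrite inE /G_adj G_adj_natE //= .
by have := ltn_ord t; do !case: ifP; lia.
Qed.

(** Both changed edges have their ends among v_1, v_2, v_4. *)
Lemma Gp_adj_far (t x : 'I_n) : (3 < t)%N -> Gp_adj k i j ni nj t x = G_adj k i j ni nj t x.
Proof. rewrite /Gp_adj /Gp_adj_nat /is_edge /G_adj => t3; lia. Qed.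

Lemma signless_far (t x : 'I_n) : (3 < t)%N -> A t x = signless (Gp_adj k i j ni nj) t x.
Proof.
move=> t3; rewrite !mxE Gp_adj_far //; case: eqP => // _; congr (Posz _).
by apply: eq_card => y; rewrite !inE Gp_adj_far.
Qed.

End Bounds.

(** * The four rows in both graphs and the sign of the difference *)

Theorem theorem2p6 (k i j ni nj : nat) :
  (3 <= k)%N -> (4 < i)%N -> (i < j)%N -> (j <= k.*2)%N ->
  per (laplacian (Gp_adj k i j ni nj)) < per (laplacian (G_adj k i j ni nj)).
Proof.
move=> k3 i4 ij j2k.
rewrite (@per_laplacian_bipartite _ _ (fun a => colour k i j ni a)); last first.
  by move=> a b; apply: Gp_adj_colour.
rewrite (@per_laplacian_bipartite _ _ (fun a => colour k i j ni a)); last first.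
  by move=> a b; apply: G_adj_colour.
have h0 : (0 < k.*2 + ni + nj)%N by lia.
have h1 : (1 < k.*2 + ni + nj)%N by lia.
have h2 : (2 < k.*2 + ni + nj)%N by lia.
have h3 : (3 < k.*2 + ni + nj)%N by lia.
have h4 : (4 < k.*2 + ni + nj)%N by lia.
have h5 : (k.*2.-1 < k.*2 + ni + nj)%N by lia.
pose v0 := Ordinal h0; pose v1 := Ordinal h1; pose v2 := Ordinal h2.
pose v3 := Ordinal h3; pose v4 := Ordinal h4; pose v5 := Ordinal h5.
(* [v5] has index 2k - 1, at least 5 because k >= 3; hence it differs from [v4]. *)
have uv : uniq [:: v0; v1; v2; v3; v4; v5] by rewrite /= !inE -!val_eqE /=; lia.
have far t : t \notin [:: v0; v1; v2; v3] -> (3 < t)%N.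
  by rewrite !inE -!val_eqE /=; lia.
set A := signless (G_adj _ _ _ _ _); set B := signless _.
have GE (a x : 'I_(k.*2 + ni + nj)) := G_adj_natE ni nj k3 i4 ij j2k a x.
have near a (x : 'I_(k.*2 + ni + nj)) := @G_adj_near _ _ _ ni nj k3 i4 ij a x.
have colA (v t : 'I_(k.*2 + ni + nj)) : (v \in [:: v1; v2]) -> (3 < t)%N -> A t v = 0.
  rewrite !inE -!val_eqE /= => hv t3; rewrite mxE -val_eqE /= ifF; last lia.
  by rewrite /G_adj GE (_ : [|| _, _, _, _ | _] = false) //; lia.
have rowA (v x : 'I_(k.*2 + ni + nj)) l : uniq (v :: l) ->
    (forall y, G_adj k i j ni nj v y = (y \in l)) ->
    A v x = (size l)%:R * (x == v)%:R + \sum_(y <- l) (x == y)%:R.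
  exact: signless_row.
have rowB (v x : 'I_(k.*2 + ni + nj)) l : uniq (v :: l) ->
    (forall y, Gp_adj k i j ni nj v y = (y \in l)) ->
    B v x = (size l)%:R * (x == v)%:R + \sum_(y <- l) (x == y)%:R.
  exact: signless_row.
rewrite -subr_gt0 (@per_sub_four_rows _ _ _ _ _ _ _ uv A B); first 1 last.
- by move=> t /far; apply: colA; rewrite !inE eqxx.
- by move=> t /far; apply: colA; rewrite !inE eqxx orbT.
- by move=> t x /far; apply: signless_far.
- move=> x; rewrite (rowA _ _ [:: v1; v5]) ?big_cons ?big_nil.
  + by rewrite /= /vtx /=; ring.
  + by rewrite /= ?inE -?val_eqE /=; lia.
  + by move=> y; rewrite /G_adj near // !inE -!val_eqE /=; lia.
- move=> x; rewrite (rowA _ _ [:: v0; v2]) ?big_cons ?big_nil.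
  + by rewrite /= /vtx /=; ring.
  + by rewrite /= ?inE -?val_eqE /=; lia.
  + by move=> y; rewrite /G_adj near // !inE -!val_eqE /=; lia.
- move=> x; rewrite (rowA _ _ [:: v1; v3]) ?big_cons ?big_nil.
  + by rewrite /= /vtx /=; ring.
  + by rewrite /= ?inE -?val_eqE /=; lia.
  + by move=> y; rewrite /G_adj near // !inE -!val_eqE /=; lia.
- move=> x; rewrite (rowA _ _ [:: v2; v4]) ?big_cons ?big_nil.
  + by rewrite /= /vtx /=; ring.
  + by rewrite /= ?inE -?val_eqE /=; lia.
  + by move=> y; rewrite /G_adj near // !inE -!val_eqE /=; lia.
(* In G', v_2 has become pendant and v_4 has degree 3. *)
- move=> x; rewrite (rowB _ _ [:: v3; v5]) ?big_cons ?big_nil.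
  + by rewrite /= /vtx /=; ring.
  + by rewrite /= ?inE -?val_eqE /=; lia.
  + by move=> y; rewrite /Gp_adj /Gp_adj_nat /is_edge near // !inE -!val_eqE /=; lia.
- move=> x; rewrite (rowB _ _ [:: v2]) ?big_cons ?big_nil.
  + by rewrite /= /vtx /=; ring.
  + by rewrite /= ?inE -?val_eqE /=; lia.
  + by move=> y; rewrite /Gp_adj /Gp_adj_nat /is_edge near // !inE -!val_eqE /=; lia.
- move=> x; rewrite (rowB _ _ [:: v1; v3]) ?big_cons ?big_nil.
  + by rewrite /= /vtx /=; ring.
  + by rewrite /= ?inE -?val_eqE /=; lia.
  + by move=> y; rewrite /Gp_adj /Gp_adj_nat /is_edge near // !inE -!val_eqE /=; lia.
- move=> x; rewrite (rowB _ _ [:: v0; v2; v4]) ?big_cons ?big_nil.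
  + by rewrite /= /vtx /=; ring.
  + by rewrite /= ?inE -?val_eqE /=; lia.
  + by move=> y; rewrite /Gp_adj /Gp_adj_nat /is_edge near // !inE -!val_eqE /=; lia.
have T0 x0 x1 x2 x3 : 0 <= rowcof v0 v1 v2 v3 A x0 x1 x2 x3.
  by apply: rowcof_ge0 => t x; apply: signless_ge0.
have T1 : 1 <= rowcof v0 v1 v2 v3 A v0 v1 v2 v3.
  apply: rowcof_id_ge1 => [t x|t /far t3]; first exact: signless_ge0.
  by rewrite mxE eqxx lez_nat gdeg_G_gt0.
(* The image of row v_1 is prescribed and not read from [A], so this row is treated apart from those
   beyond the four. *)
have valP' x : nat_of_ord x \notin [:: 1; 2; 3]%N ->
    x = v0 \/ x \notin [:: v0; v1; v2; v3].
  rewrite !inE -!val_eqE /=; case: (eqVneq x v0) => [|x0 x123]; [by left | right].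
  by rewrite -val_eqE in x0; move: x0 x123 => /=; lia.
(* t_{1l}: v_1 goes to v_{2k} and v_4 to v_1, so the permutation can only be [descend]. *)
have Tdown : rowcof v0 v1 v2 v3 A v5 v1 v2 v0 <= 1.
  apply: (@rowcof_le1 _ _ _ _ _ A
    (fun s => forall x, nat_of_ord (s x) = descend k x)).
  - move=> s s0 s1 s2 s3 sA; apply: (perm_descend (i := i) (j := j)) => //.
    + by move=> x x1; rewrite (_ : x = v1) //; apply: ord_inj.
    + by move=> x x2; rewrite (_ : x = v2) //; apply: ord_inj.
    + by move=> x x3; rewrite (_ : x = v3) ?s3 //; apply: ord_inj.
    move=> x /valP'[->|/sA/signless_neq0//].
    by right; rewrite s0 /G_adj GE /=; lia.
  - by move=> s s' Ss Ss'; apply/permP => x; apply: ord_inj; rewrite Ss Ss'.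
  move=> s t Ss /far t3; rewrite signless_ge0 signless_le1 // -val_eqE /= Ss /descend.
  by do !case: ifP; lia.
(* t_{45}: v_1 goes to v_4 and v_4 to v_5, so the path is followed upwards and the inverse is
   [descend]. *)
have Tup : rowcof v0 v1 v2 v3 A v3 v1 v2 v4 <= 1.
  apply: (@rowcof_le1 _ _ _ _ _ A
    (fun s => forall x, nat_of_ord ((s^-1)%g x) = descend k x)).
  - move=> s s0 s1 s2 s3 sA; apply: (perm_descend (i := i) (j := j)) => //.
    + move=> x x1; have -> : x = s v1; [by apply: ord_inj; rewrite s1 | by rewrite permK s1].
    + move=> x x2; have -> : x = s v2; [by apply: ord_inj; rewrite s2 | by rewrite permK s2].
    + move=> x x3; have -> : x = s v0 by apply: ord_inj; rewrite s0.
      by rewrite permK.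
    move=> x; have [t ->] : exists t, x = s t by exists ((s^-1)%g x); rewrite permKV.
    rewrite permK => st.
    case: (boolP (t \in [:: v0; v1; v2; v3])) => [|/sA/signless_neq0[->|]].
    + rewrite !inE => /or4P[] /eqP te; move: st; rewrite te ?s0 ?s1 ?s2 ?s3 //= => _.
      by right; rewrite /G_adj GE /=; lia.
    + by left.
    + by right; rewrite G_adj_sym.
  - move=> s s' Ss Ss'; apply: invg_inj; apply/permP => x.
    by apply: ord_inj; rewrite Ss Ss'.
  move=> s t Ss /far t3; rewrite signless_ge0 signless_le1 //.
  have := Ss (s t); rewrite permK -val_eqE /descend /=.
  by do !case: ifP; lia.
(* These three terms are nonnegative, so the bracket is at least 3 - 1 - 1 > 0. *)
have := T0 v0 v1 v2 v4; have := T0 v5 v1 v2 v3; have := T0 v5 v1 v2 v4.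
lia.
Qed.
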